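(* Let $G=(V,E)$ be an undirected capacitated graph and let $\alpha\ge1$, $\beta\ge1$. Suppose there exist partitions $\mathcal P_1,\mathcal P_2,\ldots,\mathcal P_L$ of $V$ such that (1) $\mathcal P_1=\{\{v\}:v\in V\}$ is the partition into singletons and $\mathcal P_L=\{V\}$; (2) for each $i\in[L-1]$, the collection of vertex weightings $\{\deg_{\partial\mathcal P_i\cup\partial C}|_C\in\mathbb R^V_{\ge0}: C\in\mathcal P_{i+1}\}$ mixes simultaneously in $G$ with congestion $\alpha$; (3) for each $i\in[L-1]$, there is a flow in $G$ with congestion $\beta$ in which each vertex $v\in V$ sends $\deg_{\partial\mathcal P_{i+1}}(v)$ flow and receives at most $\frac12\deg_{\partial\mathcal P_i}(v)$ flow. For each $i\in[L]$ let $\mathcal R_{\ge i}$ be the common refinement of $\mathcal P_i,\ldots,\mathcal P_L$, i.e. $\mathcal R_{\ge i}=\{C_i\cap\cdots\cap C_L: C_j\in\mathcal P_j \text{ for } j=i,\dots,L,\ C_i\cap\cdots\cap C_L\neq\emptyset\}$. Then $\mathcal C=\bigcup_{i\in[L]}\mathcal R_{\ge i}$ is a congestion-approximator of $G$ with quality $5L^2\alpha\beta$.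
   Context: $G=(V,E)$ is undirected with $n$ vertices, $m$ edges and edge capacities $c(e)\in[1,W]$. For $C\subseteq V$, $\partial C$ is the set of edges with exactly one endpoint in $C$, and $\delta C$ is their total capacity. For an edge set $F\subseteq E$ and $v\in V$, $\deg_F(v)$ is the total capacity of edges of $F$ incident to $v$; $\deg_F$ is viewed as a vector in $\mathbb R^V_{\ge0}$. For a partition $\mathcal P$ of $V$ (parts are called clusters), $\partial\mathcal P$ is the set of edges whose endpoints lie in different clusters. For $\mathbf x\in\mathbb R^U$ and $S\subseteq U$: $\mathbf x(S)=\sum_{v\in S}\mathbf x(v)$; $\mathbf x|_S$ equals $\mathbf x$ on $S$ and $0$ elsewhere; $|\mathbf x|$ is the entrywise absolute value; vector inequalities are entrywise. A demand is a vector $\mathbf b$ with $\mathbf b(U)=0$; a flow routes $\mathbf b$ if each vertex $v$ receives net flow $\mathbf b(v)$; a flow has congestion $\alpha$ if each edge carries at most $\alpha$ times its capacity. ''Each vertex $v$ sends $\mathbf x(v)$ flow and receives at most $\mathbf y(v)$ flow'' means each $v$ is the source of exactly $\mathbf x(v)$ and the sink of at most $\mathbf y(v)$ units of flow. A vertex weighting $\mathbf d\in\mathbb R^V_{\ge0}$ mixes in $G$ with congestion $\alpha$ if every demand $\mathbf b$ with $|\mathbf b|\le\mathbf d$ can be routed in $G$ with congestion $\alpha$; a collection $\{\mathbf d_1,\dots,\mathbf d_\ell\}$ mixes simultaneously with congestion $\alpha$ if for all demands $\mathbf b_1,\dots,\mathbf b_\ell$ with $|\mathbf b_j|\le\mathbf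 d_j$, the demand $\mathbf b_1+\dots+\mathbf b_\ell$ can be routed with congestion $\alpha$. A collection $\mathcal C$ of subsets of $V$ is a congestion-approximator of quality $\alpha$ if every demand $\mathbf b$ with $|\mathbf b(C)|\le\delta C$ for all $C\in\mathcal C$ can be routed in $G$ with congestion $\alpha$. *)

(* Defs.v *)
From mathcomp Require Import all_boot all_order all_algebra.
From mathcomp Require Import reals.

Set Implicit Arguments.
Unset Strict Implicit.
Unset Printing Implicit Defensive.

Import Order.TTheory GRing.Theory Num.Theory.

Local Open Scope ring_scope.

(* Undirected capacitated multigraph on V: the edge e joins [end1 e] and
   [end2 e].  The order of the two endpoints carries no information; it only
   fixes the sign convention of flows below. *)
Record graph (R : realType) (V E : finType) := Graph {
  end1 : E -> V;
  end2 : E -> V;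
  cap : E -> R }.

Section Vectors.
Variables (R : realType) (V : finType).
Implicit Types (x y b : {ffun V -> R}) (S : {set V}).

Definition vsum x S : R := \sum_(v in S) x v.

Definition restrict x S : {ffun V -> R} := [ffun v => if v \in S then x v else 0].

Definition is_demand b : Prop := vsum b [set: V] = 0.

Definition abs_le b x : Prop := forall v, `|b v| <= x v.

End Vectors.

Section Graphs.
Variables (R : realType) (V E : finType) (G : graph R V E).
Implicit Types (C : {set V}) (P : {set {set V}}) (F : {set E}).
Implicit Types (f : {ffun E -> R}) (b x y : {ffun V -> R}) (alpha : R).

Definition cut_edges C : {set E} :=
  [set e | (end1 G e \in C) != (end2 G e \in C)].

Definition cut_cap C : R := \sum_(e in cut_edges C) cap G e.

Definition inter_edges P : {set E} :=
  [set e | pblock P (end1 G e) != pblock P (end2 G e)].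

Definition incident (e : E) (v : V) : bool :=
  (v == end1 G e) || (v == end2 G e).

Definition deg F : {ffun V -> R} :=
  [ffun v => \sum_(e in F | incident e v) cap G e].

(* A flow assigns to e the signed amount sent from [end1 e] to [end2 e]. *)
Definition net_flow f (v : V) : R :=
  \sum_(e | end2 G e == v) f e - \sum_(e | end1 G e == v) f e.

Definition routes f b : Prop := forall v, net_flow f v = b v.

Definition has_congestion f alpha : Prop :=
  forall e, `|f e| <= alpha * cap G e.

Definition routable b alpha : Prop :=
  exists2 f, has_congestion f alpha & routes f b.

(* [r v] is the amount of flow of which v is the sink.  A vertex may be both a
   source and a sink, so its net inflow is [r v - x v]. *)
Definition sends_receives f x y : Prop :=
  exists2 r : {ffun V -> R},
    (forall v, 0 <= r v <= y v) & routes f (r - x).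

Definition mixes_simultaneously (I : finType) (A : {set I})
    (d : I -> {ffun V -> R}) alpha : Prop :=
  forall b : I -> {ffun V -> R},
    (forall j, j \in A -> is_demand (b j)) ->
    (forall j, j \in A -> abs_le (b j) (d j)) ->
    routable (\sum_(j in A) b j) alpha.

Definition congestion_approximator (CC : {set {set V}}) alpha : Prop :=
  forall b, is_demand b ->
    (forall C, C \in CC -> `|vsum b C| <= cut_cap C) ->
    routable b alpha.

End Graphs.

Section Refinement.
Variables (V : finType) (P : nat -> {set {set V}}) (L : nat).

(* All nonempty intersections D_i :&: ... :&: D_L with D_j \in P j; the
   entries of D at indices below i are irrelevant. *)
Definition refinement (i : nat) : {set {set V}} :=
  [set \bigcap_(j < L.+1 | (i <= j)%N) D j
     | D : {ffun 'I_L.+1 -> {set V}}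
         & [forall (j : 'I_L.+1 | (i <= j)%N), D j \in P j]]
  :\ set0.

Definition all_refinements : {set {set V}} :=
  \bigcup_(1 <= i < L.+1) refinement i.

End Refinement.

(* Main.v *)
(* By max-flow min-cut it suffices to bound |b(S)| by 5 L^2 alpha beta times the
   capacity of the boundary of S, for every vertex set S.  Round S to a union
   S_i of clusters of P_i, taking the clusters in which S has the majority of
   the mixing weight: a cut version of (2) bounds the degrees of the symmetric
   difference of S and S_i in the boundaries of P_(i-1) and P_i by alpha times
   the cut of S.  Every S_i is compared to S itself, so no factor compounds.
   As S_1 = S and S_L is empty or V, b(S) telescopes into the b(S_i) - b(S_(i+1)).
   The symmetric difference D of S_i and S_(i+1) is a union of cells of R_(>= i),
   so |b(S_i) - b(S_(i+1))| is at most the sum over j >= i of the degree of D in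
   the boundary of P_j.  A cut version of (3) says that this degree halves with
   j up to an additive beta times the cut of D, which is at most 3 alpha times
   the cut of S; each difference thus costs O(L alpha beta). *)
Require Import Defs.
From mathcomp Require Import all_boot all_order all_algebra.
From mathcomp Require Import reals zify lra ring.

Import Order.TTheory GRing.Theory Num.Theory.

Local Open Scope ring_scope.

Lemma sum_indicator (R : pzRingType) (T : finType) (A : {set T}) (x : T -> R) :
  \sum_(i in A) x i = \sum_i (i \in A)%:R * x i.
Proof.
rewrite big_mkcond; apply: eq_bigr => i _.
by case: ifP; rewrite ?mul1r ?mul0r.
Qed.

(** * Sums of vectors over vertex sets *)

Section VectorSums.
Context {R : realType} {V : finType}.
Implicit Types (x y b : {ffun V -> R}) (S T A B : {set V}).

Lemma vsumE x S : vsum x S = \sum_v (v \in S)%:R * x v.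
Proof. exact: sum_indicator. Qed.

Lemma vsum_ge0 x S : (forall v, 0 <= x v) -> 0 <= vsum x S.
Proof. by move=> x0; apply: sumr_ge0. Qed.

Lemma le_vsum x y S : (forall v, x v <= y v) -> vsum x S <= vsum y S.
Proof. by move=> xy; apply: ler_sum. Qed.

Lemma vsum_subU x S A B :
  (forall v, 0 <= x v) -> S \subset A :|: B -> vsum x S <= vsum x A + vsum x B.
Proof.
move=> x0 /subsetP sub; rewrite !vsumE -big_split; apply: ler_sum => v _ /=.
rewrite -mulrDl; apply: ler_wpM2r => //; rewrite -natrD ler_nat.
by case: (boolP (v \in S)) => // /sub; rewrite inE; do 2!case: (_ \in _).
Qed.

Lemma vsumUI x A B :
  vsum x (A :|: B) + vsum x (A :&: B) = vsum x A + vsum x B.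
Proof.
rewrite !vsumE -!big_split; apply: eq_bigr => v _ /=.
by rewrite -!mulrDl -!natrD !inE; do 2!case: (_ \in _).
Qed.

Definition symdiff S T := [set v | (v \in S) != (v \in T)].

Lemma vsum_symdiff x S T :
  vsum x (symdiff S T) = vsum x (S :\: T) + vsum x (T :\: S).
Proof.
rewrite !vsumE -!big_split; apply: eq_bigr => v _ /=.
by rewrite -!mulrDl -!natrD !inE; do 2!case: (_ \in _).
Qed.

Lemma vsumBD x S T :
  vsum x S - vsum x T = vsum x (S :\: T) - vsum x (T :\: S).
Proof.
rewrite !vsumE -!sumrB; apply: eq_bigr => v _ /=.
by rewrite -!mulrBl !inE; do 2!case: (_ \in _); rewrite /= ?subrr ?subr0.
Qed.

Lemma symdiff_triangle S T U : symdiff T U \subset symdiff S T :|: symdiff S U.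
Proof.
by apply/subsetP=> v; rewrite !inE; do 3!case: (_ \in _).
Qed.

End VectorSums.

(** * Cuts, flows and degrees *)

Section Cuts.
Context {R : realType} {V E : finType} (G : graph R V E).
Implicit Types (f : {ffun E -> R}) (b x : {ffun V -> R}) (S T : {set V}).
Implicit Types (F : {set E}).

Lemma vsum_net_flow f b S : routes G f b ->
  vsum b S = \sum_e ((end2 G e \in S)%:R - (end1 G e \in S)%:R) * f e.
Proof.
move=> rf.
have endE (h : E -> V) :
    \sum_(v in S) \sum_(e | h e == v) f e = \sum_e (h e \in S)%:R * f e.
  rewrite [RHS](partition_big h predT)//= big_mkcond/=; apply: eq_bigr => v _.
  case: ifP => vS; first by apply: eq_bigr => e /eqP->; rewrite vS mul1r.
  by rewrite big1 // => e /eqP->; rewrite vS mul0r.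
rewrite /vsum (eq_bigr (net_flow G f)); last by move=> v _; rewrite rf.
rewrite /net_flow sumrB !endE -sumrB.
by apply: eq_bigr => e _; rewrite mulrBl.
Qed.

Lemma vsum_le_cut f b k S :
  has_congestion G f k -> routes G f b -> `|vsum b S| <= k * cut_cap G S.
Proof.
move=> cf /vsum_net_flow ->; apply: le_trans (ler_norm_sum _ _ _) _.
rewrite /cut_cap mulr_sumr [leRHS]big_mkcond; apply: ler_sum => e _ /=.
rewrite inE normrM; do 2!case: (_ \in _) => /=;
  by rewrite ?subrr ?subr0 ?sub0r ?normrN ?normr1 ?normr0 ?mul1r ?mul0r.
Qed.

Lemma net_flow_set1 f e t :
  (forall e', e' != e -> f e' = 0) -> f e = t ->
  forall v, net_flow G f v = t * ((end2 G e == v)%:R - (end1 G e == v)%:R).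
Proof.
move=> f0 ft v; rewrite /net_flow.
have endE (h : E -> V) : \sum_(e' | h e' == v) f e' = t * (h e == v)%:R.
  rewrite big_mkcond (bigD1 e)//= big1 ?addr0 => [|e' /f0->]; last exact: if_same.
  by rewrite ft; case: eqP; rewrite ?mulr1 ?mulr0.
by rewrite !endE mulrBr.
Qed.

(* Hoffman's form of max-flow min-cut.  The flow values that may be put on a
   single edge form an interval, nonempty by submodularity of cuts. *)
Lemma cut_condition_flow (c : E -> R) (A : {set E}) b :
  (forall e, 0 <= c e) -> is_demand b ->
  (forall S, vsum b S <= \sum_(e in A :&: cut_edges G S) c e) ->
  exists2 f : {ffun E -> R},
    (forall e, `|f e| <= if e \in A then c e else 0) & routes G f b.
Proof.
move=> c0; have [n] := ubnP #|A|; elim: n => // n IHn in A b *.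
rewrite ltnS => cardA db cutb.
have [A0|[e eA]] := set_0Vmem A.
  (* With no edge left, every [vsum b S] is at most 0. The sums over [[set v]] and its complement
     add up to 0, so both vanish. *)
  have b0 S : vsum b S <= 0 by rewrite (le_trans (cutb S))// A0 set0I big_set0.
  exists [ffun=> 0] => [e|v]; first by rewrite ffunE normr0 A0 inE.
  rewrite /net_flow !big1 ?subrr; try by move=> *; rewrite ffunE.
  apply/esym/eqP; rewrite eq_le.
  have := b0 [set v]; have := b0 (~: [set v]); move: db.
  rewrite /is_demand /vsum (bigID [in [set v]])/= => db.
  rewrite (eq_bigl [pred w | w \notin [set v]]); last by move=> w; rewrite !inE.
  move: db; rewrite (eq_bigl (mem [set v])) ?big_set1; last first.
    by move=> w; rewrite !inE.
  rewrite (eq_bigl [pred w | w \notin [set v]]); last by move=> w; rewrite !inE.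
  lra.
set u := end1 G e; set v := end2 G e.
pose d S := \sum_(e' in (A :\ e) :&: cut_edges G S) c e'.
have dE S : \sum_(e' in A :&: cut_edges G S) c e' =
    (if (u \in S) != (v \in S) then c e else 0) + d S.
  case: ifP => eS.
    rewrite (bigD1 e) ?inE ?eA//=; congr (_ + _); apply: eq_bigl => e'.
    by rewrite !inE; case: (e' == e); rewrite ?andbF ?andbT.
  rewrite add0r; apply: eq_bigl => e'; rewrite !inE.
  by case: (eqVneq e' e) => //= ->; rewrite [LHS]andbC eS.
have d_submod S T : d (S :|: T) + d (S :&: T) <= d S + d T.
  have dm U : d U = \sum_(e' in A :\ e)
      (if (end1 G e' \in U) != (end2 G e' \in U) then c e' else 0).
    rewrite /d -big_mkcondr; apply: eq_bigl => e'.
    by rewrite in_setI [in X in _ && X]inE.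
  rewrite !dm -!big_split; apply: ler_sum => e' _ /=; rewrite !inE.
  have := c0 e'; do 4!case: (_ \in _) => /=; lra.
(* [t] is the least admissible flow from [u] to [v] along [e]: each set containing [v] but not [u]
   gives a lower bound, and the default [- c e] is the capacity bound. *)
pose t : R := \big[Num.max/- c e]_(S : {set V} | (v \in S) && (u \notin S))
  (vsum b S - d S).
have t_ge S : v \in S -> u \notin S -> vsum b S - d S <= t.
  by move=> vS uS; apply: le_bigmax_cond; rewrite vS.
have t_ge_c : - c e <= t by apply: bigmax_ge_id.
have t_le_c : t <= c e.
  apply: bigmax_le => [|S /andP[vS uS]]; first by have := c0 e; lra.
  by have := cutb S; rewrite dE vS (negPf uS) /=; lra.
(* [S :|: T] contains both [u] and [v], and [S :&: T] neither, so [e] crosses neither set. Their cut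
   conditions and the submodularity of [d] make the lower bound from [S] compatible with the upper
   bound from [T]. *)
have t_le T : u \in T -> v \notin T -> t <= d T - vsum b T.
  move=> uT vT; apply: bigmax_le => [|S /andP[vS uS]].
    by have := cutb T; rewrite dE uT (negPf vT) /=; lra.
  have := d_submod S T; have := vsumUI b S T.
  have := cutb (S :|: T); have := cutb (S :&: T).
  rewrite !dE !inE uT vS (negPf uS) (negPf vT) /=; lra.
pose ft : {ffun E -> R} := [ffun e' => if e' == e then t else 0].
have netft w : net_flow G ft w = t * ((v == w)%:R - (u == w)%:R).
  apply: net_flow_set1; last by rewrite ffunE eqxx.
  by move=> e' /negPf ne; rewrite ffunE ne.
(* The demand left to the edges of [A :\ e] once [e] carries [t]; the bounds on [t] yield its cut
   condition. *)
pose b' := b - [ffun w => net_flow G ft w].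
have b'E S : vsum b' S = vsum b S - t * ((v \in S)%:R - (u \in S)%:R).
  have -> : vsum b' S = vsum b S - vsum [ffun w => net_flow G ft w] S.
    by rewrite /vsum -sumrB; apply: eq_bigr => w _; rewrite !ffunE.
  congr (_ - _); rewrite (@vsum_net_flow ft) => [|w]; last by rewrite ffunE.
  rewrite (bigD1 e)//= big1 ?addr0; first by rewrite ffunE eqxx mulrC.
  by move=> e' /negPf ne; rewrite ffunE ne mulr0.
have [||S|f cf rf] := IHn (A :\ e) b'.
- by move: cardA; rewrite (cardsD1 e A) eA.
- by rewrite /is_demand b'E db !inE subrr mulr0 subrr.
- rewrite b'E -/(d S).
  have := cutb S; rewrite dE; have := t_ge S; have := t_le S.
  case: (u \in S) => /=; case: (v \in S) => /=.
  + lra.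
  + by move=> /(_ isT isT); lra.
  + by move=> _ /(_ isT isT); lra.
  + lra.
exists (f + ft) => [e'|w].
  rewrite !ffunE; have := cf e'; rewrite !inE.
  case: eqVneq => [-> /=|_ /=]; last by rewrite addr0.
  by rewrite normr_le0 eA => /eqP->; rewrite add0r ler_norml t_ge_c.
have addE (Q : pred E) :
    \sum_(e' | Q e') (f + ft) e' = \sum_(e' | Q e') f e' + \sum_(e' | Q e') ft e'.
  by rewrite -big_split; apply: eq_bigr => e' _; rewrite ffunE.
have := rf w; rewrite /b' !ffunE /net_flow !addE; lra.
Qed.

Lemma cut_condition_routable b k : (forall e, 0 <= cap G e) -> 0 <= k ->
  is_demand b -> (forall S, vsum b S <= k * cut_cap G S) -> routable G b k.
Proof.
move=> cap0 k0 db cutb.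
have [|//|S|f cf rf] := @cut_condition_flow (fun e => k * cap G e) setT b.
- by move=> e; rewrite mulr_ge0.
- by rewrite setTI -mulr_sumr.
by exists f => // e; have := cf e; rewrite inE.
Qed.

Hypothesis cap_ge0 : forall e, 0 <= cap G e.

Lemma deg_ge0 F v : 0 <= deg G F v.
Proof. by rewrite ffunE; apply: sumr_ge0. Qed.

Lemma cut_cap_ge0 S : 0 <= cut_cap G S.
Proof. exact: sumr_ge0. Qed.

Lemma deg_sub F1 F2 v :
  (forall e, e \in F1 -> incident G e v -> e \in F2) ->
  deg G F1 v <= deg G F2 v.
Proof.
move=> sub; rewrite !ffunE !(big_mkcond (fun e => _ && _)).
apply: ler_sum => e _; have := cap_ge0 e; have := sub e.
case: (e \in F1) => /=; last by case: ifP.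
by case: (incident G e v) => [/(_ isT isT)->|]; rewrite //= andbF.
Qed.

Definition touching F S : {set E} :=
  [set e in F | (end1 G e \in S) || (end2 G e \in S)].

Lemma touching_le_deg F S :
  \sum_(e in touching F S) cap G e <= vsum (deg G F) S.
Proof.
rewrite /vsum; under [leRHS]eq_bigr do rewrite ffunE big_mkcondr.
rewrite exchange_big/= big_mkcond [leRHS]big_mkcond; apply: ler_sum => e _ /=.
rewrite inE; case: (e \in F) => //=; case: ifP => [eS|_]; last first.
  by apply: sumr_ge0 => v _; case: ifP.
have [w wS we] : exists2 w, w \in S & incident G e w.
  case/orP: eS => eS; [exists (end1 G e)|exists (end2 G e)];
  by rewrite // /incident eqxx ?orbT.
rewrite (bigD1 w)//= we lerDl; apply: sumr_ge0 => v _.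
by case: ifP.
Qed.

Lemma cut_cap_le_deg F S :
  cut_edges G S \subset F -> cut_cap G S <= vsum (deg G F) S.
Proof.
move=> /subsetP sub; apply: le_trans (touching_le_deg F S).
rewrite /cut_cap !sum_indicator; apply: ler_sum => e _.
apply: ler_wpM2r => //; rewrite ler_nat; have := sub e; rewrite !inE.
do 2!case: (_ \in S) => //=; rewrite ?andbT;
  by [move=> ->|move=> _; case: (_ \in F)].
Qed.

(** An edge cut by [symdiff T1 T2] is cut by [T1] or [T2], say [T1], hence lies in [F1]. If [S] does
    not cut it, exactly one of its endpoints is in [symdiff S T1], where its capacity is charged. *)
Lemma cut_cap_symdiff F1 F2 S T1 T2 :
  cut_edges G T1 \subset F1 -> cut_edges G T2 \subset F2 ->
  cut_cap G (symdiff T1 T2) <=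
  cut_cap G S + vsum (deg G F1) (symdiff S T1) + vsum (deg G F2) (symdiff S T2).
Proof.
move=> /subsetP sub1 /subsetP sub2.
apply: le_trans (lerD (lerD (lexx _) (touching_le_deg _ _)) (touching_le_deg _ _)).
rewrite /cut_cap !sum_indicator -!big_split; apply: ler_sum => e _ /=.
rewrite -!mulrDl; apply: ler_wpM2r => //; rewrite -!natrD ler_nat.
have := sub1 e; have := sub2 e; rewrite !inE.
case: (e \in F1); case: (e \in F2); do 6!case: (_ \in _) => //=;
  by [move=> /(_ isT)|move=> _ /(_ isT)].
Qed.

End Cuts.

(** * Unions of clusters of one partition *)

Section Partitions.
Context {R : realType} {V E : finType} (G : graph R V E).
Implicit Types (b x : {ffun V -> R}) (S T D : {set V}) (F : {set E}).

(** For a partition [Q] of the vertex set, this says that [T] is a union of clusters. *)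
Definition saturated (Q : {set {set V}}) T : Prop :=
  forall v w, pblock Q v = pblock Q w -> (v \in T) = (w \in T).

Lemma saturated_cut Q T : saturated Q T -> cut_edges G T \subset inter_edges G Q.
Proof.
move=> satT; apply/subsetP=> e; rewrite !inE; apply: contra => /eqP eQ.
by rewrite (satT _ _ eQ).
Qed.

Lemma vsum_partition Q x D : partition Q [set: V] ->
  vsum x D = \sum_(C in Q) vsum x (C :&: D).
Proof.
case/and3P=> /eqP covQ tiQ _.
rewrite /vsum (partition_big (pblock Q) (mem Q))/= => [|v _]; last first.
  by apply: pblock_mem; rewrite covQ inE.
apply: eq_bigr => C CQ; apply: eq_bigl => v; rewrite inE andbC; congr (_ && _).
apply/eqP/idP => [<-|]; first by rewrite mem_pblock covQ inE.
exact: def_pblock.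
Qed.

(** The factor scaling a side of weight [p] down to the lighter of two sides. At [p = 0] the
    convention that the inverse of 0 is 0 gives the factor 0, consistent with a minimum equal to
    0. *)
Lemma min_div (p q : R) : 0 <= p -> 0 <= q ->
  [/\ 0 <= Num.min p q / p, Num.min p q / p <= 1
    & Num.min p q / p * p = Num.min p q].
Proof.
move=> p0 q0; have m0 : 0 <= Num.min p q by rewrite le_min p0.
have [->|pN0] := eqVneq p 0.
  by rewrite invr0 !mulr0 lexx ler01; split=> //; rewrite min_l.
have p_gt0 : 0 < p by rewrite lt_def pN0.
by rewrite divr_ge0// ler_pdivrMr// mul1r ge_min lexx mulfVK.
Qed.

Hypothesis cap_ge0 : forall e, 0 <= cap G e.

(* [T] collects the clusters whose larger part, by mixing weight, lies in [S].
   The demand sending the smaller side of each cluster to the larger side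
   must cross the boundary of [S]. *)
Lemma mixing_majority Q F alpha S : partition Q [set: V] ->
  mixes_simultaneously G Q
    (fun C => restrict (deg G (F :|: cut_edges G C)) C) alpha ->
  exists T, [/\ saturated Q T,
    vsum (deg G F) (symdiff S T) <= alpha * cut_cap G S
    & vsum (deg G (inter_edges G Q)) (symdiff S T) <= alpha * cut_cap G S].
Proof.
move=> partQ mix; have /and3P[/eqP covQ tiQ _] := partQ.
pose d C := deg G (F :|: cut_edges G C).
have d0 C v : 0 <= d C v by apply: deg_ge0.
pose p C := vsum (d C) (C :&: S); pose q C := vsum (d C) (C :\: S).
have p0 C : 0 <= p C by apply: vsum_ge0.
have q0 C : 0 <= q C by apply: vsum_ge0.
have pE C : p C = \sum_v (v \in C :&: S)%:R * d C v by apply: vsumE.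
have qE C : q C = \sum_v (v \in C :\: S)%:R * d C v by apply: vsumE.
pose m C := Num.min (p C) (q C).
pose T := [set v | q (pblock Q v) < p (pblock Q v)].
(* Both sides of [C] are scaled to total [m C], with opposite signs, so that [b C] is a demand
   dominated by [d C]. *)
pose b (C : {set V}) : {ffun V -> R} :=
  [ffun v => if v \in C then
     if v \in S then m C / p C * d C v else - (m C / q C * d C v) else 0].
have mp C : [/\ 0 <= m C / p C, m C / p C <= 1 & m C / p C * p C = m C].
  exact: min_div.
have mq C : [/\ 0 <= m C / q C, m C / q C <= 1 & m C / q C * q C = m C].
  by rewrite /m minC; apply: min_div.
have bS C : vsum (b C) S = m C.
  have [_ _ <-] := mp C; rewrite vsumE {2}pE mulr_sumr; apply: eq_bigr => v _.
  rewrite ffunE inE; do 2!case: (_ \in _) => /=; ring.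
have bD C : vsum (b C) [set: V] = 0.
  have [_ _ mpE] := mp C; have [_ _ mqE] := mq C.
  transitivity (m C / p C * p C - m C / q C * q C); last by rewrite mpE mqE subrr.
  rewrite vsumE {2}pE {2}qE !mulr_sumr -sumrB; apply: eq_bigr => v _.
  rewrite ffunE !inE; do 2!case: (_ \in _) => /=; ring.
have babs C : abs_le (b C) (restrict (d C) C).
  move=> v; rewrite ffunE [restrict _ _ _]ffunE.
  case: ifP => _; last by rewrite normr0.
  have [mp0 mp1 _] := mp C; have [mq0 mq1 _] := mq C.
  by case: ifP => _; rewrite ?normrN normrM !ger0_norm// ler_piMl.
have [f cf rf] := mix b (fun C _ => bD C) (fun C _ => babs C).
have summ : \sum_(C in Q) m C <= alpha * cut_cap G S.
  apply: le_trans (le_trans (ler_norm _) (vsum_le_cut _ _ _ _ S cf rf)).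
  rewrite le_eqVlt; apply/orP; left; apply/eqP.
  under eq_bigr do rewrite -bS.
  rewrite /vsum exchange_big/=; apply: eq_bigr => v _.
  by rewrite sum_ffunE.
(* Inside [C], the set [symdiff S T] is the lighter side; a tie leaves [C] out of [T]. *)
have mT C : C \in Q -> m C = vsum (d C) (C :&: symdiff S T).
  move=> CQ; have TC v : v \in C -> (v \in T) = (q C < p C).
    by move=> vC; rewrite inE (def_pblock tiQ CQ vC).
  rewrite /m; case: (leP (p C) (q C)) => [pq|qp]; rewrite ?pE ?qE vsumE;
    apply: eq_bigr => v _; congr (_%:R * _); rewrite [in LHS]inE [in RHS]inE.
    case: (boolP (v \in C)) => //= vC.
    by rewrite inE TC// ltNge pq /=; case: (v \in S).
  case: (boolP (v \in C)) => vC; rewrite ?andbF//= inE TC// qp.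
  by case: (v \in S).
have bound x : (forall C v, C \in Q -> v \in C -> x v <= d C v) ->
    vsum x (symdiff S T) <= alpha * cut_cap G S.
  move=> xd; apply: le_trans summ; rewrite (vsum_partition Q)//.
  apply: ler_sum => C CQ; rewrite mT//; apply: ler_sum => v.
  by rewrite inE => /andP[vC _]; apply: xd.
exists T; split.
- by move=> v w vw; rewrite !inE vw.
- by apply: bound => C v _ _; apply: deg_sub => // e eF _; rewrite inE eF.
(* An edge between clusters that is incident to a vertex of [C] leaves [C], so [d C] counts it. *)
- apply: bound => C v CQ vC; apply: deg_sub => // e.
  have inC w : (w \in C) = (pblock Q w == C).
    by apply/idP/eqP => [/(def_pblock tiQ CQ)//|<-]; rewrite mem_pblock covQ inE.
  rewrite !inE => eQ /orP[]/eqP ve; move: eQ; rewrite !inC -ve;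
    move: vC; rewrite inC => /eqP ->; rewrite eqxx;
    by rewrite ?(eq_sym C) => /negPf ->; rewrite orbT.
Qed.

(** Whatever [D] sends in excess of what it receives must cross its boundary. *)
Lemma flow_cut_le f x y beta D :
  has_congestion G f beta -> sends_receives G f x y ->
  vsum x D <= vsum y D + beta * cut_cap G D.
Proof.
move=> cf [r ry rf]; have := vsum_le_cut _ _ _ _ D cf rf.
have -> : vsum (r - x) D = vsum r D - vsum x D.
  by rewrite /vsum -sumrB; apply: eq_bigr => v _; rewrite !ffunE.
have : vsum r D <= vsum y D by apply: le_vsum => v; case/andP: (ry v).
rewrite ler_norml => ? /andP[? _]; lra.
Qed.

(** The map [pc] sends a vertex to its cell, and [D] is a union of cells. Each cell contributes at
    most its cut, which its own degree in [F] pays for. *)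
Lemma vsum_le_cells b F (pc : V -> {set V}) D :
  (forall v, v \in pc v) -> (forall v w, w \in pc v -> pc w = pc v) ->
  (forall v, cut_edges G (pc v) \subset F) ->
  (forall v, `|vsum b (pc v)| <= cut_cap G (pc v)) ->
  (forall v w, w \in pc v -> (w \in D) = (v \in D)) ->
  `|vsum b D| <= vsum (deg G F) D.
Proof.
move=> pcv pcw cutF bpc Dpc.
have cellE x : vsum x D = \sum_(C in [set pc v | v in D]) vsum x C.
  rewrite /vsum (partition_big pc (mem [set pc v | v in D]))/= => [|v vD].
    apply: eq_bigr => _ /imsetP[v vD ->]; apply: eq_bigl => w.
    apply/andP/idP => [[_ /eqP<-]//|wv]; last by rewrite (Dpc _ _ wv) (pcw _ _ wv).
  exact: imset_f.
rewrite !cellE; apply: le_trans (ler_norm_sum _ _ _) _.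
apply: ler_sum => _ /imsetP[v _ ->]; apply: le_trans (bpc v) _.
exact: cut_cap_le_deg.
Qed.

End Partitions.

(** * The sequence of partitions and its refinements *)

Section Levels.
Context {R : realType} {V E : finType} (G : graph R V E).
Implicit Types (b x : {ffun V -> R}) (S T D : {set V}).
Hypothesis cap_ge0 : forall e, 0 <= cap G e.
Variables (L : nat) (P : nat -> {set {set V}}).
Hypothesis partP : forall i : nat, (1 <= i <= L)%N -> partition (P i) [set: V].

Definition cell i v : {set V} := \bigcap_(j < L.+1 | (i <= j)%N) pblock (P j) v.

Lemma mem_level_pblock i v : (1 <= i <= L)%N -> v \in pblock (P i) v.
Proof. by case/partP/and3P => /eqP cov _ _; rewrite mem_pblock cov inE. Qed.

Lemma mem_cell i v w : (1 <= i)%N ->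
  reflect (forall j : nat, (i <= j <= L)%N -> pblock (P j) w = pblock (P j) v)
          (w \in cell i v).
Proof.
move=> i1; apply: (iffP bigcapP) => [wv j /andP[ij jL]|wv j ij].
  have wj : w \in pblock (P j) v by apply: (wv (Ordinal (jL : (j < L.+1)%N))).
  have jr : (1 <= j <= L)%N by rewrite (leq_trans i1).
  have /and3P[/eqP cov tiP _] := partP _ jr.
  by apply: def_pblock => //; rewrite pblock_mem// cov inE.
have jL : (j <= L)%N by rewrite -ltnS ltn_ord.
by rewrite -wv ?ij// mem_level_pblock// (leq_trans i1 ij).
Qed.

Lemma cell_refinement i v : (1 <= i)%N -> cell i v \in refinement P L i.
Proof.
move=> i1; rewrite 2!inE; apply/andP; split.
  by apply/set0Pn; exists v; apply/mem_cell.
apply/imsetP; exists [ffun j : 'I_L.+1 => pblock (P j) v].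
  rewrite inE; apply/forallP => j; apply/implyP => ij; rewrite ffunE.
  have jr : (1 <= j <= L)%N by rewrite (leq_trans i1 ij) -ltnS ltn_ord.
  by have /and3P[/eqP cov _ _] := partP _ jr; rewrite pblock_mem// cov inE.
by apply: eq_bigr => j _; rewrite ffunE.
Qed.

Variable b : {ffun V -> R}.
Hypothesis bcut :
  forall C, C \in all_refinements P L -> `|vsum b C| <= cut_cap G C.

Local Notation ldeg i := (deg G (inter_edges G (P i))).

(** An edge outside all boundaries of levels [i] to [L] has both endpoints in the same cell, so the
    union [F] of these boundaries contains the boundary of every cell. *)
Lemma vsum_le_level_degrees i D : (1 <= i <= L)%N ->
  (forall v w, w \in cell i v -> (w \in D) = (v \in D)) ->
  `|vsum b D| <= \sum_(i <= j < L.+1) vsum (ldeg j) D.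
Proof.
move=> /andP[i1 iL] Dcell.
pose F := \bigcup_(j < L.+1 | (i <= j)%N) inter_edges G (P j).
apply: (@le_trans _ _ (vsum (deg G F) D)).
  apply: (vsum_le_cells _ cap_ge0 _ _ (cell i)) => //.
  - by move=> v; apply/mem_cell.
  - move=> v w /mem_cell - /(_ i1) wv; apply/setP=> z.
    by apply/(mem_cell _ _ _ i1)/(mem_cell _ _ _ i1) => zw j jr; rewrite zw// wv.
  - move=> v; apply/subsetP=> e; rewrite inE; apply: contraR => eF.
    have eP j : (i <= j <= L)%N -> pblock (P j) (end1 G e) = pblock (P j) (end2 G e).
      move=> /andP[ij jL]; apply/eqP; apply: contraR eF => ne; apply/bigcupP.
      by exists (Ordinal (jL : (j < L.+1)%N)); rewrite ?inE.
    apply/eqP; apply/(mem_cell _ _ _ i1)/(mem_cell _ _ _ i1) => ev j jr;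
      by rewrite -ev// eP.
  - move=> v; apply: bcut; rewrite /all_refinements.
    rewrite (bigD1_seq i) ?mem_index_iota ?iota_uniq ?i1//=.
    by rewrite inE cell_refinement.
(* The degree in a union of edge sets is at most the sum of the degrees. *)
rewrite /vsum exchange_big/=; apply: ler_sum => v _.
under [leRHS]eq_bigr do rewrite ffunE big_mkcondr/=.
rewrite ffunE big_mkcondr/= big_mkcond/=.
rewrite (eq_bigr (fun j => \sum_e (if e \in inter_edges G (P j) then
  if incident G e v then cap G e else 0 else 0))); last first.
  by move=> j _; rewrite big_mkcond.
rewrite exchange_big/=; apply: ler_sum => e _.
have c0 : 0 <= (if incident G e v then cap G e else 0) by case: ifP.
case: ifP => [/bigcupP[j ij ej]|_]; last first.
  by apply: sumr_ge0 => j _; case: ifP.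
rewrite (bigD1_seq (j : nat)) ?mem_index_iota ?iota_uniq ?ij ?ltn_ord//=.
by rewrite ej lerDl; apply: sumr_ge0 => k _; case: ifP.
Qed.

Variables (alpha beta : R).
Hypotheses (alpha1 : 1 <= alpha) (beta1 : 1 <= beta).
Hypothesis PL : P L = [set [set: V]].
Hypothesis mixP : forall i : nat, (1 <= i < L)%N ->
  mixes_simultaneously G (P i.+1)
    (fun C => restrict (deg G (inter_edges G (P i) :|: cut_edges G C)) C) alpha.
Hypothesis flowP : forall i : nat, (1 <= i < L)%N ->
  exists2 f : {ffun E -> R}, has_congestion G f beta &
    sends_receives G f (ldeg i.+1) [ffun v => ldeg i v / 2].
Hypothesis db : is_demand b.

Lemma level_degree_decay i D : (1 <= i < L)%N ->
  vsum (ldeg i.+1) D <= vsum (ldeg i) D / 2 + beta * cut_cap G D.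
Proof.
case/flowP => f cf sf; have := flow_cut_le _ _ _ _ _ D cf sf.
congr (_ <= _ + _); rewrite /vsum mulr_suml.
by apply: eq_bigr => v _; rewrite ffunE.
Qed.

(* Counting the last term twice makes the geometric decay telescope. *)
Lemma sum_level_degrees i n D : (1 <= i)%N -> (i + n <= L)%N ->
  \sum_(i <= j < (i + n).+1) vsum (ldeg j) D + vsum (ldeg (i + n)) D <=
  2 * vsum (ldeg i) D + 2 * n%:R * (beta * cut_cap G D).
Proof.
move=> i1; elim: n => [|n IHn] inL.
  by rewrite addn0 big_nat1 mulr0n; lra.
rewrite addnS in inL *; rewrite big_nat_recr/=; last by rewrite leqW ?leq_addr.
(* Twice the new degree is at most the previous one plus [2 * (beta * cut_cap G D)]; the extra copy
   of the previous degree pays for it. *)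
have := level_degree_decay (i + n) D; rewrite inL (leq_trans i1) ?leq_addr//.
move=> /(_ isT); have := IHn (ltnW inL); rewrite -(natr1 n); lra.
Qed.

(** [T'] is the majority rounding of [S], not of [T]. With [D] the symmetric difference of [T] and
    [T'], its degree at level [i] is at most 2 [alpha] cuts of [S], doubled to 4 by the geometric
    sum; its cut is at most 3 [alpha] cuts of [S], and each of the [L - i] further levels costs
    [2 * beta] times that. *)
Lemma saturated_next i S T : (1 <= i < L)%N -> saturated (P i) T ->
  vsum (ldeg i) (symdiff S T) <= alpha * cut_cap G S ->
  exists T', [/\ saturated (P i.+1) T',
    vsum (ldeg i.+1) (symdiff S T') <= alpha * cut_cap G S &
    `|vsum b T - vsum b T'| <=
      (4 + 6 * (L - i)%:R) * (alpha * beta * cut_cap G S)].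
Proof.
move=> iL satT degT; have /andP[i1 iltL] := iL.
have partQ : partition (P i.+1) [set: V] by apply: partP; rewrite iltL.
have [T' [satT' degT' degT'2]] := mixing_majority _ cap_ge0 _ _ _ S partQ (mixP _ iL).
exists T'; split=> //.
have cutS0 : 0 <= cut_cap G S by apply: cut_cap_ge0.
pose D := symdiff T T'.
have degD : vsum (ldeg i) D <= 2 * (alpha * cut_cap G S).
  have := vsum_subU (ldeg i) _ _ _ (deg_ge0 _ cap_ge0 _) (symdiff_triangle S T T').
  rewrite -/D; lra.
have cutD : cut_cap G D <= 3 * (alpha * cut_cap G S).
  have := cut_cap_symdiff _ cap_ge0 _ _ S _ _ (saturated_cut G _ _ satT)
    (saturated_cut G _ _ satT').
  have : cut_cap G S <= alpha * cut_cap G S by apply: ler_peMl.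
  rewrite -/D; lra.
have sumD : \sum_(i <= j < L.+1) vsum (ldeg j) D <=
    (4 + 6 * (L - i)%:R) * (alpha * beta * cut_cap G S).
  have := sum_level_degrees i (L - i) D i1; rewrite subnKC ?leqnn 1?ltnW// => /(_ isT).
  have : 0 <= vsum (ldeg L) D by apply: vsum_ge0 => v; apply: deg_ge0.
  have : (L - i)%:R * (beta * cut_cap G D) <=
         (L - i)%:R * (beta * (3 * (alpha * cut_cap G S))).
    by rewrite ler_wpM2l// ler_wpM2l// (le_trans ler01).
  have : alpha * cut_cap G S <= alpha * cut_cap G S * beta.
    by rewrite ler_peMr// mulr_ge0// (le_trans ler01).
  lra.
(* [T :\: T'] and [T' :\: T] are separately unions of cells, and their degrees add up to that of
   [D]. *)
apply: le_trans sumD; rewrite vsumBD; apply: le_trans (ler_normB _ _) _.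
have cellT v w : w \in cell i v -> (w \in T) = (v \in T) /\ (w \in T') = (v \in T').
  move=> /mem_cell - /(_ i1) wv; split; [apply: satT|apply: satT']; apply: wv.
    by rewrite leqnn ltnW.
  by rewrite leqnSn.
under [leRHS]eq_bigr do rewrite vsum_symdiff.
rewrite big_split; apply: lerD; apply: vsum_le_level_degrees;
  rewrite ?i1 1?ltnW// => v w /cellT[wT wT']; by rewrite !inE wT wT'.
Qed.

Lemma saturated_top T : saturated (P L) T -> vsum b T = 0.
Proof.
move=> satT; have [->|[v vT]] := set_0Vmem T; first by rewrite /vsum big_set0.
suff -> : T = [set: V] by [].
apply/setP=> w; rewrite inE -vT; apply: satT.
have tiP : trivIset (P L).
  by apply/trivIsetP => A B; rewrite PL !inE => /eqP-> /eqP->; rewrite eqxx.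
by rewrite !(def_pblock tiP (B := setT)) ?PL ?inE.
Qed.

(** Induction on the distance [n] to the top level, where [vsum b T] vanishes. [S] stays fixed while
    [T] changes with the level. *)
Lemma vsum_saturated_le n S T : (n < L)%N -> saturated (P (L - n)) T ->
  vsum (ldeg (L - n)) (symdiff S T) <= alpha * cut_cap G S ->
  `|vsum b T| <= (3 * n%:R ^+ 2 + 7 * n%:R) * (alpha * beta * cut_cap G S).
Proof.
elim: n T => [|n IHn] T nL satT degT.
  rewrite subn0 in satT; rewrite saturated_top// normr0 mulr0n; lra.
have r : (1 <= L - n.+1 < L)%N by lia.
have [T' []] := saturated_next _ S T r satT degT.
have -> : (L - n.+1).+1 = (L - n)%N by lia.
have -> : (L - (L - n.+1))%N = n.+1 by lia.
move=> satT' degT' step; have := IHn T' (ltnW nL) satT' degT'.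
have := ler_normD (vsum b T - vsum b T') (vsum b T'); rewrite subrK.
(* 3(n+1)^2 + 7(n+1) = (3n^2 + 7n) + (4 + 6(n+1)) *)
move: step; rewrite -(natr1 n); lra.
Qed.

End Levels.

Theorem theorem4p1 (R : realType) (V E : finType) (G : graph R V E)
  (W : R) (hcap : forall e : E, 1 <= cap G e <= W)
  (alpha beta : R) (halpha : 1 <= alpha) (hbeta : 1 <= beta)
  (L : nat) (hL : (1 <= L)%N) (P : nat -> {set {set V}})
  (hpart : forall i : nat, (1 <= i <= L)%N -> partition (P i) [set: V])
  (hP1 : P 1%N = [set [set v] | v : V])
  (hPL : P L = [set [set: V]])
  (hmix : forall i : nat, (1 <= i < L)%N ->
     mixes_simultaneously G (P i.+1)
       (fun C : {set V} =>
          restrict (deg G (inter_edges G (P i) :|: cut_edges G C)) C)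
       alpha)
  (hflow : forall i : nat, (1 <= i < L)%N ->
     exists2 f : {ffun E -> R},
       has_congestion G f beta &
       sends_receives G f (deg G (inter_edges G (P i.+1)))
         [ffun v : V => deg G (inter_edges G (P i)) v / 2]) :
  congestion_approximator G (all_refinements P L)
    (5 * L%:R ^+ 2 * alpha * beta).
Proof.
have cap0 e : 0 <= cap G e by case/andP: (hcap e) => /(le_trans ler01).
have a0 : 0 <= alpha by apply: le_trans halpha.
have b0 : 0 <= beta by apply: le_trans hbeta.
move=> b db bcut; apply: cut_condition_routable => // [|S].
  by rewrite !mulr_ge0// exprn_ge0.
have L1 : (L - L.-1)%N = 1%N by lia.
have cutS0 : 0 <= cut_cap G S by apply: cut_cap_ge0.
(* At level 1 the clusters are singletons, so [S] can serve as its own rounding. *)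
have satS : saturated (P (L - L.-1)%N) S.
  move=> v w; rewrite L1 => vw; congr (_ \in S).
  have := mem_level_pblock _ _ hpart 1%N v hL.
  have : pblock (P 1%N) w \in P 1%N.
    by rewrite pblock_mem// (cover_partition (hpart 1%N hL)) inE.
  have := mem_level_pblock _ _ hpart 1%N w hL; rewrite vw hP1.
  by move=> wp /imsetP[z _ pz]; move: wp; rewrite pz !inE => /eqP-> /eqP->.
have degS : vsum (deg G (inter_edges G (P (L - L.-1)%N))) (symdiff S S) <=
    alpha * cut_cap G S.
  by rewrite /vsum big1 ?mulr_ge0// => v; rewrite inE eqxx.
have LL : (L.-1 < L)%N by lia.
have := vsum_saturated_le _ cap0 _ _ hpart _ bcut _ _ halpha hbeta hPL hmix hflow
  db _ _ _ LL satS degS.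
move=> /(le_trans (ler_norm _)) /le_trans; apply.
have -> : 5 * L%:R ^+ 2 * alpha * beta * cut_cap G S =
    5 * L%:R ^+ 2 * (alpha * beta * cut_cap G S) by ring.
rewrite ler_wpM2r ?mulr_ge0//.
(* With [n = L.-1] it remains to compare [3 n^2 + 7 n] with [5 (n + 1)^2]. *)
have -> : L%:R = L.-1%:R + 1 :> R by rewrite natr1 prednK.
have : (0 : R) <= L.-1%:R by [].
nra.
Qed.
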